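(* Let $k\ge 1$, let $X_1,\dots,X_k$ be pairwise disjoint finite nonempty sets with $|X_i|=n_i$, let $G=\prod_{i=1}^k\mathrm{GL}(n_i)$, and for each $i$ let $V_i\cong\mathbb C^{n_i}$ be the fundamental representation of $\mathrm{GL}(n_i)$. Let $P(\mathbf x)=\sum_{f\in\mathrm{EC}}w(f)$ be the generating polynomial of eventually constant $k$-tuples on $X_1,\dots,X_k$. Then $P(\mathbf x)$ can be written as the virtual character $$P(\mathbf x)=\chi\!\left(\bigotimes_{i=1}^k V_i^{\otimes n_{i-1}}-2^k\bigotimes_{i=1}^k\left(V_i^{\otimes(n_{i-1}-2)}\otimes\Lambda^2V_i\right)\right),$$ with indices understood modulo $k$.
   Context: Indices are modulo $k$, so $X_{k+1}=X_1$ and $n_0=n_k$. A $k$-tuple $f=(f_1,\dots,f_k)$ with $f_i:X_i\to X_{i+1}$ is eventually constant if $(f_k\cdots f_1)^m:X_1\to X_1$ is constant for some $m\ge1$; $\mathrm{EC}$ is the set of these. There is one commuting variable $x_v$ for each $v\in\bigsqcup_iX_i$, and $w(f)=\prod_{i=1}^k\prod_{v\in X_i}x_{f_i(v)}$. Each $V_i$ is regarded as a representation of $G$ through the projection $G\to\mathrm{GL}(n_i)$. For a representation $W$ of $G$, $\chi(W)$ is its character as a function of $\mathbf x=(x_v)$: the trace on $W$ of the element $(\mathrm{diag}(x_v)_{v\in X_1},\dots,\mathrm{diag}(x_v)_{v\in X_k})$; $\chi$ is extended additively to formal integer combinations (virtual representations). If some $n_j=1$, then $\Lambda^2V_j=0$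 and the second tensor product is read as $0$. *)

(* Defs.v *)
From HB Require Import structures.
From mathcomp Require Import all_boot all_order all_algebra.
From mathcomp Require Import boolp complex mxtens mpoly.
From mathcomp Require Import ring.

Set Implicit Arguments.
Unset Strict Implicit.
Unset Printing Implicit Defensive.

Import Order.TTheory GRing.Theory Num.Theory.
Local Open Scope ring_scope.

Section GeneralLinear.
Variables (F : fieldType) (n : nat).

Record GL : Type := MkGL { GL_mx :> 'M[F]_n; GL_unitmx : GL_mx \in unitmx }.

HB.instance Definition _ := [isSub for GL_mx].
HB.instance Definition _ := [Choice of GL by <:].

Fact GL_mul_subproof (g h : GL) : g *m h \in unitmx.
Proof. by rewrite unitmx_mul !GL_unitmx. Qed.

Fact GL_inv_subproof (g : GL) : invmx g \in unitmx.
Proof. by rewrite unitmx_inv (GL_unitmx g). Qed.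

Definition GL_one : GL := MkGL (unitmx1 F n).
Definition GL_mul (g h : GL) : GL := MkGL (GL_mul_subproof g h).
Definition GL_inv (g : GL) : GL := MkGL (GL_inv_subproof g).

Fact GL_mulA : associative GL_mul.
Proof. by move=> g h l; apply: val_inj; rewrite /= mulmxA. Qed.

Fact GL_mul1 : left_id GL_one GL_mul.
Proof. by move=> g; apply: val_inj; rewrite /= mul1mx. Qed.

Fact GL_1mul : right_id GL_one GL_mul.
Proof. by move=> g; apply: val_inj; rewrite /= mulmx1. Qed.

Fact GL_mulV : left_inverse GL_one GL_inv GL_mul.
Proof. by move=> g; apply: val_inj; rewrite /= mulVmx // (GL_unitmx g). Qed.

Fact GL_Vmul : right_inverse GL_one GL_inv GL_mul.
Proof. by move=> g; apply: val_inj; rewrite /= mulmxV // (GL_unitmx g). Qed.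

HB.instance Definition _ :=
  isGroup.Build GL GL_mulA GL_mul1 GL_1mul GL_mulV GL_Vmul.

Fact GL_diag_subproof (d : 'rV[F]_n) :
  (forall j, d 0 j != 0) -> diag_mx d \in unitmx.
Proof.
by move=> d0; rewrite unitmxE det_diag unitfE; apply/prodf_neq0 => j _.
Qed.

Definition GL_diag (d : 'rV[F]_n) (d0 : forall j, d 0 j != 0) : GL :=
  MkGL (GL_diag_subproof d0).

End GeneralLinear.

Section ProductGroup.
Variables (I : finType) (H : I -> groupType).

Definition prodG : Type := {dffun forall i, H i}.

HB.instance Definition _ := Choice.on prodG.

Definition prodG_one : prodG := [ffun i => 1%g].
Definition prodG_mul (g h : prodG) : prodG := [ffun i => (g i * h i)%g].
Definition prodG_inv (g : prodG) : prodG := [ffun i => (g i)^-1%g].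

Fact prodG_mulA : associative prodG_mul.
Proof. by move=> g h l; apply/ffunP => i; rewrite !ffunE mulgA. Qed.

Fact prodG_mul1 : left_id prodG_one prodG_mul.
Proof. by move=> g; apply/ffunP => i; rewrite !ffunE mul1g. Qed.

Fact prodG_1mul : right_id prodG_one prodG_mul.
Proof. by move=> g; apply/ffunP => i; rewrite !ffunE mulg1. Qed.

Fact prodG_mulV : left_inverse prodG_one prodG_inv prodG_mul.
Proof. by move=> g; apply/ffunP => i; rewrite !ffunE mulVg. Qed.

Fact prodG_Vmul : right_inverse prodG_one prodG_inv prodG_mul.
Proof. by move=> g; apply/ffunP => i; rewrite !ffunE mulgV. Qed.

HB.instance Definition _ :=
  isGroup.Build prodG prodG_mulA prodG_mul1 prodG_1mul prodG_mulV prodG_Vmul.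

Definition prodG_proj (i : I) (g : prodG) : H i := g i.

Fact prodG_proj_is_monoid_morphism i : monoid.monoid_morphism (prodG_proj i).
Proof. by split=> [|g h]; rewrite /prodG_proj ffunE. Qed.

HB.instance Definition _ i :=
  isUMagmaMorphism.Build prodG (H i) (prodG_proj i)
    (prodG_proj_is_monoid_morphism i).

End ProductGroup.

(* A group element acts on column vectors by left multiplication. *)
Record rep (F : fieldType) (G : groupType) := Rep {
  rep_dim : nat;
  rep_mx :> G -> 'M[F]_rep_dim;
  rep_mx1 : rep_mx 1%g = 1%:M;
  rep_mxM : forall g h, rep_mx (g * h)%g = rep_mx g *m rep_mx h
}.

Section Constructions.
Variables (F : fieldType) (G : groupType).

Definition rep_triv : rep F G :=
  @Rep F G 1 (fun=> 1%:M) erefl (fun _ _ => esym (mulmx1 _)).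

Definition rep_fund n : rep F (GL F n) :=
  @Rep F (GL F n) n (@GL_mx F n) erefl (fun _ _ => erefl).

Section Pullback.
Variables (H : groupType) (phi : UMagmaMorphism.type G H) (V : rep F H).

Fact rep_pull1 : V (phi 1%g) = 1%:M.
Proof. by rewrite gmulf1 rep_mx1. Qed.

Fact rep_pullM g h : V (phi (g * h)%g) = V (phi g) *m V (phi h).
Proof. by rewrite gmulfM rep_mxM. Qed.

Definition rep_pull : rep F G := Rep rep_pull1 rep_pullM.
End Pullback.

Section Tensor.
Variables V W : rep F G.

Fact rep_tens1 : V 1%g *t W 1%g = 1%:M.
Proof.
rewrite !rep_mx1; apply/matrixP => i j.
rewrite !mxE -natrM mulnb; congr (_%:R); congr nat_of_bool.
by rewrite -[RHS](inj_eq (can_inj (@mxtens_unindexK _ _))) xpair_eqE.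
Qed.

Fact rep_tensM g h : V (g * h)%g *t W (g * h)%g = V g *t W g *m (V h *t W h).
Proof. by rewrite !rep_mxM tensmx_mul. Qed.

Definition rep_tens : rep F G := Rep rep_tens1 rep_tensM.
End Tensor.

Definition rep_tpow (V : rep F G) (n : nat) : rep F G :=
  iter n (rep_tens V) rep_triv.

Definition rep_bigtens (k : nat) (V : 'I_k -> rep F G) : rep F G :=
  \big[rep_tens/rep_triv]_(i < k) V i.

End Constructions.

Section ExteriorSquare.
Variables (F : fieldType) (n : nat).

Definition wpairs : {set 'I_n * 'I_n} := [set p : 'I_n * 'I_n | (p.1 < p.2)%N].

(* u /\ v in the basis e_a /\ e_b, a < b, of the exterior square of F^n. *)
Definition wedge (u v : 'cV[F]_n) : 'cV[F]_#|wpairs| :=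
  \col_i let p := enum_val i in u p.1 0 * v p.2 0 - u p.2 0 * v p.1 0.

(* The column of index (a, b) is A e_a /\ A e_b. *)
Definition ext2mx (A : 'M[F]_n) : 'M[F]_#|wpairs| :=
  \matrix_(i, j) let q := enum_val j in wedge (col q.1 A) (col q.2 A) i 0.

Lemma ext2mx_wedge A u v :
  ext2mx A *m wedge u v = wedge (A *m u) (A *m v).
Proof.
apply/colP => i; rewrite !mxE.
set p := enum_val i.
pose M a b := A p.1 a * A p.2 b - A p.2 a * A p.1 b.
have anti a b : M b a = - M a b by rewrite /M; ring.
have diag a : M a a = 0 by rewrite /M mulrC subrr.
transitivity (\sum_a \sum_b M a b * (u a 0 * v b 0)); last first.
  rewrite /= !mxE !mulr_suml -sumrB; apply: eq_bigr => a _.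
  rewrite !mulr_sumr -sumrB; apply: eq_bigr => b _.
  by rewrite /M; ring.
transitivity (\sum_(q in wpairs) M q.1 q.2 * (u q.1 0 * v q.2 0 - u q.2 0 * v q.1 0)).
  rewrite [RHS]big_enum_val; apply: eq_bigr => j _.
  by rewrite !mxE /= !mxE /= !mxE.
rewrite pair_big /= [RHS](bigID (fun q : 'I_n * 'I_n => (q.1 < q.2)%N)) /=.
rewrite [X in _ = _ + X](bigID (fun q : 'I_n * 'I_n => (q.2 < q.1)%N)) /=.
rewrite [X in _ = _ + (_ + X)]big1 ?addr0; last first.
  move=> [a b] /=; rewrite -!leqNgt -eqn_leq => /eqP ab.
  by rewrite (val_inj ab : b = a) diag mul0r.
rewrite [X in _ = _ + X](reindex (fun q : 'I_n * 'I_n => (q.2, q.1))) /=; last first.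
  by exists (fun q : 'I_n * 'I_n => (q.2, q.1)) => -[].
rewrite [X in _ = _ + X](eq_bigl (fun q : 'I_n * 'I_n => (q.1 < q.2)%N)); last first.
  by move=> [a b] /=; case: ltngtP.
rewrite -big_split /=; apply: eq_big => [q|q _]; first by rewrite inE.
by rewrite (anti q.1 q.2); ring.
Qed.

Lemma ext2mx1 : ext2mx 1%:M = 1%:M.
Proof.
apply/matrixP => i j; rewrite !mxE /= !mxE /= !mxE.
have := enum_valP i; have := enum_valP j; rewrite !inE.
rewrite -(inj_eq enum_val_inj).
case: (enum_val i) (enum_val j) => [a b] [c d] /= cd ab.
rewrite xpair_eqE -!natrM !mulnb.
have -> : (b == c) && (a == d) = false.
  apply/negP => /andP[/eqP bc /eqP ad].
  by move: cd; rewrite -bc -ad ltnNge ltnW.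
by rewrite subr0.
Qed.

Lemma ext2mxM A B : ext2mx (A *m B) = ext2mx A *m ext2mx B.
Proof.
apply/matrixP => i j; rewrite [LHS]mxE /= !colE -!mulmxA -ext2mx_wedge -!colE.
by rewrite [LHS]mxE [RHS]mxE; apply: eq_bigr => l _; rewrite [ext2mx B l j]mxE.
Qed.

End ExteriorSquare.

Section RepExteriorSquare.
Variables (F : fieldType) (G : groupType) (V : rep F G).

Fact rep_ext21 : ext2mx (V 1%g) = 1%:M.
Proof. by rewrite rep_mx1 ext2mx1. Qed.

Fact rep_ext2M g h : ext2mx (V (g * h)%g) = ext2mx (V g) *m ext2mx (V h).
Proof. by rewrite rep_mxM ext2mxM. Qed.

Definition rep_ext2 : rep F G := Rep rep_ext21 rep_ext2M.

End RepExteriorSquare.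

(* A formal integer combination of representations is the list of its terms. *)
Definition virtual_rep (F : fieldType) (G : groupType) : Type :=
  seq (int * rep F G).

Definition virtual_char (F : fieldType) (G : groupType)
    (W : virtual_rep F G) (g : G) : F :=
  \sum_(c <- W) c.1%:~R * \tr (c.2 g).

Section Tuples.
(* The disjoint union of the X i is the sigma type {i & X i}; the indices    *)
(* 1, ..., k become 0, ..., k - 1, and i + 1 and i - 1 modulo k are ordS i   *)
(* and ord_pred i.                                                           *)
Variables (k : nat) (X : 'I_k -> finType).

Definition ktuple : finType := {dffun forall i : 'I_k, {ffun X i -> X (ordS i)}}.

Definition ktuple_step (f : ktuple) (u : {i : 'I_k & X i}) : {i : 'I_k & X i} :=
  Tagged X (f (tag u) (tagged u)).

(* The composite of the k successive maps of f starting from X i: following  *)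
(* f for k steps in the disjoint union leads back to X i, so that tagged_as  *)
(* never uses its default value (see ktuple_roundE).                         *)
Definition ktuple_round (f : ktuple) (i : 'I_k) (v : X i) : X i :=
  tagged_as (Tagged X v) (iter k (ktuple_step f) (Tagged X v)).

Lemma tag_iter_ktuple_step f m u :
  tag (iter m (ktuple_step f) u) = ((tag u + m) %% k)%N :> nat.
Proof.
elim: m => [|m IHm] /=; first by rewrite addn0 modn_small.
by rewrite IHm -addn1 modnDml addn1 addnS.
Qed.

Lemma ktuple_roundE f i (v : X i) :
  Tagged X (ktuple_round f v) = iter k (ktuple_step f) (Tagged X v).
Proof.
have tagE : tag (iter k (ktuple_step f) (Tagged X v)) = i.
  by apply: val_inj; rewrite /= tag_iter_ktuple_step modnDr modn_small.
have castE (u w : {i : 'I_k & X i}) : tag w = tag u -> Tagged X (tagged_as u w) = w.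
  case: u w => [a y] [b z] /= ba; move: y; case: _ / ba => y.
  by rewrite (@tagged_asE _ X).
exact: (castE (Tagged X v)).
Qed.

Definition eventually_constant (hk : (0 < k)%N) (f : ktuple) : Prop :=
  exists2 m, (1 <= m)%N &
    exists c : X (Ordinal hk), forall v, iter m (@ktuple_round f _) v = c.

Definition EC (hk : (0 < k)%N) : {set ktuple} :=
  [set f | `[< eventually_constant hk f >] ].

Section Weights.
Variable F : fieldType.

Definition xvar (u : {i : 'I_k & X i}) : {mpoly F[#|{: {i : 'I_k & X i}}|]} :=
  'X_(enum_rank u).

Definition weight (f : ktuple) : {mpoly F[#|{: {i : 'I_k & X i}}|]} :=
  \prod_(i < k) \prod_(v : X i) xvar (Tagged X (f i v)).

Definition EC_poly (hk : (0 < k)%N) : {mpoly F[#|{: {i : 'I_k & X i}}|]} :=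
  \sum_(f in EC hk) weight f.

Definition poly_at (p : {mpoly F[#|{: {i : 'I_k & X i}}|]})
    (x : {i : 'I_k & X i} -> F) : F :=
  p.@[fun j => x (enum_val j)].

Definition prodGL : groupType := prodG (fun i => GL F #|X i|).

Definition fundV (i : 'I_k) : rep F prodGL :=
  rep_pull (prodG_proj (H := fun i => GL F #|X i|) i) (rep_fund F #|X i|).

Definition torus_row (x : {i : 'I_k & X i} -> F) (i : 'I_k) : 'rV[F]_#|X i| :=
  \row_j x (Tagged X (enum_val j)).

Fact torus_row_neq0 x : (forall u, x u != 0) -> forall i j, torus_row x i 0 j != 0.
Proof. by move=> x0 i j; rewrite mxE. Qed.

Definition torus (x : {i : 'I_k & X i} -> F) (x0 : forall u, x u != 0) : prodGL :=
  [ffun i => GL_diag (@torus_row_neq0 x x0 i)].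

Definition chi (W : virtual_rep F prodGL)
    (x : {i : 'I_k & X i} -> F) (x0 : forall u, x u != 0) : F :=
  virtual_char W (torus x0).

End Weights.
End Tuples.

(* Main.v *)
(* Write S_i and p_2(X_i) for the sum of the x_v and of the x_v^2 over X_i.
   Since 2 chi(Lambda^2 V_i) = S_i^2 - p_2(X_i), the claim is that the sum D of
   ([f in EC] - 1 + [f p_i <> f q_i for all i]) w(f) vanishes, where p_i <> q_i
   are fixed points of X_i (if some X_i is a singleton then every f is in EC and
   the second product is 0).  Setting x_u = 0 leaves only the f which avoid u;
   then f u is free and matters neither to EC nor to the closed form, so D is a
   multiple of its analogue for the layers with u removed, and vanishes by
   induction.  By inclusion-exclusion D is thus the sum over surjective f only,
   and these are injective, hence not in EC, and separate all p_i, q_i: their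
   coefficient is 0 - 1 + 1 = 0. *)
Require Import Defs.
From mathcomp Require Import all_boot all_order all_algebra.
From mathcomp Require Import reals complex.
From mathcomp Require Import boolp mxtens mpoly zify.

Set Implicit Arguments.
Unset Strict Implicit.
Unset Printing Implicit Defensive.
Import GRing.Theory.
Local Open Scope ring_scope.

(** * Weighted sums over self-maps of a finite set *)

Section FiniteMaps.
Variables (R : comNzRingType) (T : finType).
Implicit Types (A : {set T}) (f : {ffun T -> T}) (x : T -> R).

Definition map_weight A x f : R := \prod_(v in A) x (f v).

Definition kill (u : T) x : T -> R := fun v => if v == u then 0 else x v.

Lemma map_weight_kill A x u f :
  map_weight A (kill u x) f = if u \in f @: A then 0 else map_weight A x f.
Proof.
case: ifPn => [/imsetP[v vA ->]|uf].
  by rewrite /map_weight (bigD1 v) //= /kill eqxx mul0r.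
apply: eq_bigr => v vA; rewrite /kill; case: eqP => // fvu.
by case/negP: uf; rewrite -fvu imset_f.
Qed.

(* Inclusion-exclusion over the image: killing u removes the maps that hit u. *)
Lemma weighted_sum_eq0 A (P : pred {ffun T -> T}) (c : {ffun T -> T} -> R) :
  (forall x u, u \in A -> \sum_(f | P f) c f * map_weight A (kill u x) f = 0) ->
  (forall f, P f -> A \subset f @: A -> c f = 0) ->
  forall x, \sum_(f | P f) c f * map_weight A x f = 0.
Proof.
move=> killed onto x.
(* The points of [s] are imposed one at a time: the maps that miss [u] contribute exactly the sum at
   [kill u x], which is 0. Generality in [x] lets the induction hypothesis apply at [kill u x]
   too. *)
have hits s : {subset s <= A} -> forall x,
    \sum_(f | P f && all (mem (f @: A)) s) c f * map_weight A x f
    = \sum_(f | P f) c f * map_weight A x f.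
  elim: s => [_ {}x|u s IHs sA {}x]; first by apply: eq_bigl => f; rewrite andbT.
  have uA : u \in A by apply: sA; rewrite mem_head.
  have {}sA : {subset s <= A} by move=> v vs; apply: sA; rewrite inE vs orbT.
  rewrite -(IHs sA x) [RHS](bigID (fun f => u \in f @: A)) /=.
  have := killed x u uA; rewrite -(IHs sA) (bigID (fun f => u \in f @: A)) /=.
  rewrite big1 ?add0r; last first.
    by move=> f /andP[_ uf]; rewrite map_weight_kill uf mulr0.
  under eq_bigr => f /andP[_ /negbTE uf] do rewrite map_weight_kill uf.
  move=> ->; rewrite addr0; apply: eq_bigl => f.
  by rewrite -andbA; congr andb; rewrite andbC.
rewrite -(hits (enum A)); last by move=> v; rewrite mem_enum.
apply: big1 => f /andP[Pf /allP fA]; rewrite onto ?mul0r //.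
by apply/subsetP => v vA; apply: fA; rewrite mem_enum.
Qed.

End FiniteMaps.

(** * Maps respecting a cyclic layering, and when they merge *)

Section LayeredMaps.
Variables (R : comNzRingType) (T : finType) (t0 : T) (k : nat) (lay : T -> 'I_k).
Implicit Types (A : {set T}) (f : {ffun T -> T}) (x : T -> R).

Definition layer A (i : 'I_k) : {set T} := [set v in A | lay v == i].

(** Pinning the values outside [A] to [t0] makes each layered map of [A] correspond to exactly one
    [f], also after [A] shrinks. *)
Definition layered A : {pred {ffun T -> T}} :=
  pfamily t0 (mem A) (fun v => mem (layer A (ordS (lay v)))).

(** Eventual constancy without a distinguished first layer, so that any vertex can be removed. *)
Definition merging A f : Prop :=
  exists m, {in A &, forall u v, lay u = lay v -> iter m f u = iter m f v}.

Lemma layeredP A f :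
  reflect ((forall v, v \notin A -> f v = t0) /\
           (forall v, v \in A -> f v \in A /\ lay (f v) = ordS (lay v)))
          (f \in layered A).
Proof.
apply: (iffP pfamilyP) => -[offA onA]; split.
- move=> v vA; apply/eqP/negPn; apply: contra vA; exact: (subsetP offA).
- by move=> v vA; have := onA v vA; rewrite !inE => /andP[-> /eqP].
- apply/subsetP => v; rewrite unfold_in; apply: contraR => vA; exact/eqP/offA.
- by move=> v vA; have [fvA lv] := onA v vA; rewrite !inE fvA lv eqxx.
Qed.

Lemma layered_iter A f m v : f \in layered A -> v \in A ->
  iter m f v \in A /\ lay (iter m f v) = iter m (@ordS k) (lay v).
Proof.
move=> /layeredP[_ onA] vA; elim: m => [//|m [IHA IHl]] /=.
by have [fA ->] := onA _ IHA; rewrite IHl.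
Qed.

Lemma val_iter_ordS m (i : 'I_k) : iter m (@ordS k) i = ((i + m) %% k)%N :> nat.
Proof.
elim: m => [|m IHm] /=; first by rewrite addn0 modn_small.
by rewrite IHm -addn1 modnDml addn1 addnS.
Qed.

Lemma iter_ordS_onto (i j : 'I_k) : exists2 m, (m <= k)%N & iter m (@ordS k) i = j.
Proof.
case: (leqP i j) => ij.
  exists (j - i)%N; first by have := ltn_ord j; lia.
  by apply: val_inj; rewrite /= val_iter_ordS subnKC ?modn_small.
exists (k + j - i)%N; first by lia.
apply: val_inj; rewrite /= val_iter_ordS subnKC ?modnDl ?modn_small //.
by have := ltn_ord i; lia.
Qed.

(** All vertices of one layer reach the single point of layer [i] after the same number [m <= k] of
    steps; the other [k - m] steps keep them together. *)
Lemma singleton_merging A f i : f \in layered A -> #|layer A i| = 1%N -> merging A f.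
Proof.
move=> fA /eqP/cards1P[w Ai]; exists k => u v uA vA uv.
have [m mk mi] := iter_ordS_onto (lay u) i.
have hit z : z \in A -> lay z = lay u -> iter m f z = w.
  move=> zA zu; apply/eqP; rewrite -in_set1 -Ai inE.
  by have [-> ->] := layered_iter m fA zA; rewrite zu mi eqxx.
by rewrite -(subnK mk) !iterD !hit.
Qed.

Lemma inj_not_merging A f u v : f \in layered A -> {in A &, injective f} ->
  u \in A -> v \in A -> lay u = lay v -> u != v -> ~ merging A f.
Proof.
move=> fA finj uA vA luv uv [m /(_ u v uA vA luv)].
elim: m => [/eqP|m IHm]; first exact/negP.
by move/finj => /(_ (layered_iter m fA uA).1 (layered_iter m fA vA).1).
Qed.

(** One step brings [A] into [B], where [f] and [g] agree, so a single extra iteration carries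
    merging from [B] to [A]. *)
Lemma merging_restrict A (B : {set T}) f (g : {ffun T -> T}) : f \in layered A -> B \subset A ->
  {in B, f =1 g} -> (forall v, v \in A -> f v \in B) -> merging A f <-> merging B g.
Proof.
move=> fA BA fg AB.
have iterE m v : v \in B -> iter m f v \in B /\ iter m f v = iter m g v.
  move=> vB; elim: m => [//|m [IHB IHE]] /=.
  by split; [apply/AB/(subsetP BA) | rewrite (fg _ IHB) IHE].
split=> -[m mP].
  exists m => u v uB vB; rewrite -(iterE m u uB).2 -(iterE m v vB).2.
  by apply: mP; exact: (subsetP BA).
exists m.+1 => u v uA vA uv; rewrite !iterSr.
rewrite (iterE m _ (AB u uA)).2 (iterE m _ (AB v vA)).2.
apply: mP; try exact: AB.
have /layeredP[_ onA] := fA.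
by rewrite (onA u uA).2 (onA v vA).2 uv.
Qed.

(** * Product formulas for sums over layered maps *)

Definition layer_sum A x i : R := \sum_(v in layer A i) x v.

Definition layer_sum2 A x i : R := \sum_(v in layer A i) x v ^+ 2.

(** The values at distinct vertices are chosen independently. *)
Lemma sum_layered_prod A (F : T -> T -> R) :
  \sum_(f in layered A) \prod_(v in A) F v (f v)
  = \prod_i \prod_(v in layer A i) \sum_(u in layer A (ordS i)) F v u.
Proof.
rewrite -big_distr_big_dep (partition_big lay predT) //=.
apply: eq_bigr => i _; apply: eq_big => v; first by rewrite inE.
by case/andP => _ /eqP ->.
Qed.

Lemma sum_layered_weight A x :
  \sum_(f in layered A) map_weight A x f
  = \prod_i layer_sum A x (ordS i) ^+ #|layer A i|.
Proof.
rewrite (sum_layered_prod A (fun=> x)); apply: eq_bigr => i _.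
by rewrite prodr_const.
Qed.

(* Each factor 1 - [f (p i) = f (q i)] is written as a sum over an optional
   common value y, so that the sum over f factors over the vertices. *)
Lemma sum_layered_separated A x (p q : 'I_k -> T) :
  (forall i, p i \in layer A i) -> (forall i, q i \in layer A i) ->
  (forall i, p i != q i) ->
  \sum_(f in layered A) (\prod_i (f (p i) != f (q i))%:R) * map_weight A x f
  = \prod_i layer_sum A x (ordS i) ^+ (#|layer A i| - 2)
    * \prod_i (layer_sum A x i ^+ 2 - layer_sum2 A x i).
Proof.
move=> pA qA pq.
(* [sg] carries the sign and the membership of a common value [y]; [kap] forces it at [p i] and
   [q i] and leaves the other vertices free. *)
pose sg i (o : option T) : R :=
  if o is Some y then - (y \in layer A (ordS i))%:R else 1.
pose kap (z : {ffun 'I_k -> option T}) v u : R :=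
  if z (lay v) is Some y then
    if (v == p (lay v)) || (v == q (lay v)) then (u == y)%:R else 1
  else 1.
have layp i : lay (p i) = i by have := pA i; rewrite inE => /andP[_ /eqP].
have layq i : lay (q i) = i by have := qA i; rewrite inE => /andP[_ /eqP].
have inA v i : v \in layer A i -> v \in A by rewrite inE => /andP[].
have sepE f : f \in layered A -> \prod_i (f (p i) != f (q i))%:R
    = \sum_(z : {ffun 'I_k -> option T})
        (\prod_i sg i (z i)) * \prod_(v in A) kap z v (f v).
  move=> fA; pose t i o : R := sg i o *
    (if o is Some y then (f (p i) == y)%:R * (f (q i) == y)%:R else 1).
  transitivity (\prod_i \sum_o t i o).
    apply: eq_bigr => i _.
    rewrite (bigD1 None) //= {1}/t /= mulr1.
    rewrite (reindex_onto (@Some T) (odflt t0)) /=; last by case.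
    rewrite (bigD1 (f (p i))) /=; last by rewrite eqxx.
    rewrite big1 => [|y /andP[_ yfp]]; last first.
      by rewrite /t eq_sym (negbTE yfp) mul0r mulr0.
    have /layeredP[_ /(_ _ (inA _ _ (pA i)))[fpA lfp]] := fA.
    rewrite addr0 /t /= eqxx !inE fpA lfp layp eqxx mul1r mulN1r eq_sym.
    by case: eqP; rewrite ?subrr ?subr0.
  rewrite bigA_distr_bigA /=; apply: eq_bigr => z _.
  rewrite big_split /=; congr (_ * _).
  rewrite (partition_big lay predT) //=; apply: eq_bigr => i _.
  rewrite (bigD1 (p i)) /=; last by rewrite (inA _ _ (pA i)) layp eqxx.
  rewrite (bigD1 (q i)) /=; last by rewrite (inA _ _ (qA i)) layq eq_sym pq eqxx.
  rewrite [X in _ * (_ * X)]big1 ?mulr1; last first.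
    move=> v /andP[/andP[/andP[_ /eqP lv] vp] vq].
    by rewrite /kap lv (negbTE vp) (negbTE vq); case: (z i).
  rewrite /kap layp layq !eqxx orbT /=.
  by case: (z i) => //; rewrite mulr1.
rewrite (eq_bigr _ (fun f fA => congr1 ( *%R^~ _) (sepE f fA))) /=.
rewrite (eq_bigr _ (fun f _ => mulr_suml _ _ _ _)) exchange_big /=.
(* With a common value [y], the two chosen vertices contribute [x y ^+ 2] and the other
   [#|layer A i| - 2] are free; without one, all are free. *)
pose G i o : R := sg i o * (if o is Some y then
   x y ^+ 2 * layer_sum A x (ordS i) ^+ (#|layer A i| - 2)
   else layer_sum A x (ordS i) ^+ #|layer A i|).
have card2 i : (#|layer A i| = (#|layer A i| - 2).+2)%N.
  by rewrite (cardsD1 (p i)) pA (cardsD1 (q i) (_ :\ _)) in_setD1 qA eq_sym pq; lia.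
transitivity (\sum_(z : {ffun 'I_k -> option T}) \prod_i G i (z i)).
  apply: eq_bigr => z _.
  under eq_bigr => f _ do rewrite -mulrA /map_weight -big_split /=.
  rewrite -mulr_sumr (sum_layered_prod A (fun v u => kap z v u * x u)).
  rewrite -big_split /=; apply: eq_bigr => i _; rewrite /G.
  have kapE v : v \in layer A i -> kap z v =1 fun u =>
      if z i is Some y then
        if (v == p i) || (v == q i) then (u == y)%:R else 1
      else 1.
    by rewrite inE /kap => /andP[_ /eqP ->].
  case: (z i) kapE => [y|] kapE /=; last first.
    congr (_ * _); rewrite -prodr_const; apply: eq_bigr => v vi.
    by apply: eq_bigr => u _; rewrite kapE // mul1r.
  case: (boolP (y \in _)) => [yi|]; last by rewrite oppr0 !mul0r.
  have pick v : v \in layer A i -> (v == p i) || (v == q i) ->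
      \sum_(u in layer A (ordS i)) kap z v u * x u = x y.
    move=> vi vpq; rewrite (bigD1 y) //= kapE // vpq eqxx mul1r big1 ?addr0 //.
    by move=> u /andP[_ /negbTE uy]; rewrite kapE // vpq uy mul0r.
  congr (_ * _); rewrite (bigD1 (p i)) //= pick ?eqxx //.
  rewrite (bigD1 (q i)) /=; last by rewrite qA eq_sym pq.
  rewrite pick ?eqxx ?orbT // mulrA -expr2; congr (_ * _).
  have -> : (#|layer A i| - 2)%N = #|layer A i :\ p i :\ q i|.
    by rewrite (cardsD1 (p i) (layer A i)) pA (cardsD1 (q i) (_ :\ _)) in_setD1 qA eq_sym pq; lia.
  rewrite -prodr_const; apply: eq_big => v.
    by rewrite !(in_setD1, inE); case: (v == p i); case: (v == q i); rewrite ?andbF ?andbT.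
  case/andP => /andP[vi /negbTE vp] /negbTE vq.
  by apply: eq_bigr => u _; rewrite kapE // vp vq mul1r.
rewrite -bigA_distr_bigA /=.
(* The values at [p i] and [q i] lie in layer [ordS i], hence the shift. *)
rewrite [X in _ * X](reindex_inj (can_inj (@ordSK k))) -big_split /=.
apply: eq_bigr => i _; rewrite (bigD1 None) //= {1}/G /= mul1r.
rewrite (reindex_onto (@Some T) (odflt t0)) /=; last by case.
under eq_bigl => y do rewrite eqxx.
rewrite {1}(card2 i) -addn2 exprD mulrBr; congr (_ + _).
rewrite /layer_sum2 mulrC mulr_suml [LHS]big_mkcond [in RHS]big_mkcond -sumrN.
apply: eq_bigr => y _; rewrite /G /=; case: ifP => _; last by rewrite oppr0 mul0r.
by rewrite mulN1r.
Qed.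

(** * Removal of a vertex *)

Definition point_update (u v : T) f : {ffun T -> T} :=
  [ffun z => if z == u then v else f z].

Lemma layer_setD1 A u i : layer (A :\ u) i = layer A i :\ u.
Proof. by apply/setP => v; rewrite !inE andbA. Qed.

(** This splits a map avoiding [u] into its value at [u] and a map on [A :\ u]. Excluding [u] as a
    value matters when [k = 1], where the next layer is that of [u] itself. *)
Lemma layered_update A u v (g : {ffun T -> T}) : u \in A -> g u = t0 ->
  (point_update u v g \in layered A) && (u \notin point_update u v g @: A)
  = (v \in layer A (ordS (lay u)) :\ u) && (g \in layered (A :\ u)).
Proof.
move=> uA gu; set f := point_update u v g.
have fu : f u = v by rewrite ffunE eqxx.
have fE z : z != u -> f z = g z by rewrite ffunE => /negbTE ->.
apply/andP/andP => -[].
  move=> /layeredP[offA onA] ufA; split.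
    have [fuA lfu] := onA u uA; rewrite !inE -fu fuA lfu eqxx !andbT.
    by apply: contraNneq ufA => {1}<-; apply: imset_f.
  apply/layeredP; split=> z; rewrite !inE.
    by rewrite negb_and negbK; have [->|zu] //= := eqVneq z u; rewrite -fE //; apply: offA.
  case/andP=> zu zA; have [fzA lfz] := onA z zA; rewrite -fE // fzA lfz andbT; split=> //.
  by apply: contraNneq ufA => {1}<-; apply: imset_f.
rewrite !inE => /andP[vu /andP[vA /eqP lv]] /layeredP[offB onB]; split.
  apply/layeredP; split=> z zA.
    have zu : z != u by apply: contraNneq zA => ->.
    by rewrite fE // offB // !inE (negbTE zA) andbF.
  have [->|zu] := eqVneq z u; first by rewrite fu.
  by have := onB z; rewrite !inE zu zA fE // => /(_ isT)[/andP[_ ->] ->].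
apply/imsetP => -[z zA]; have [->|zu] := eqVneq z u.
  by rewrite fu => uv; rewrite uv eqxx in vu.
by rewrite fE // => ug; have := onB z; rewrite !inE zu zA -ug eqxx => /(_ isT)[].
Qed.

(** By [merging_restrict], merging of a map that avoids [u] does not depend on its value at [u];
    summing over that value gives the [layer_sum]. *)
Lemma sum_merging_remove A u x : u \in A -> x u = 0 ->
  \sum_(f in layered A | `[< merging A f >]) map_weight A x f
  = layer_sum A x (ordS (lay u)) *
    \sum_(g in layered (A :\ u) | `[< merging (A :\ u) g >]) map_weight (A :\ u) x g.
Proof.
move=> uA xu; rewrite (bigID (fun f => u \in f @: A)) /= big1 ?add0r; last first.
  move=> f /andP[_ /imsetP[v vA uf]].
  by rewrite /map_weight (bigD1 v) //= -uf xu mul0r.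
have -> : layer_sum A x (ordS (lay u)) = \sum_(v in layer A (ordS (lay u)) :\ u) x v.
  rewrite /layer_sum (bigID (pred1 u)) /= big1 ?add0r => [|v /andP[_ /eqP ->] //].
  by apply: eq_bigl => v; rewrite in_setD1 andbC.
rewrite big_distrlr pair_big_dep /=.
(* The inverse records [f u] and resets it to [t0], the value that [layered (A :\ u)] prescribes at
   [u]. *)
rewrite (reindex_onto (fun vg : T * {ffun T -> T} => point_update u vg.1 vg.2)
    (fun f => (f u, point_update u t0 f))) /=; last first.
  move=> f _; apply/ffunP => z; rewrite !ffunE; case: eqP => [->|] //.
have updK v (g : {ffun T -> T}) : ((point_update u v g u,
    point_update u t0 (point_update u v g)) == (v, g)) = (g u == t0).
  rewrite xpair_eqE ffunE !eqxx /=; apply/eqP/eqP => [<-|gu].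
    by rewrite ffunE eqxx.
  by apply/ffunP => z; rewrite !ffunE; case: eqP => // ->.
apply: eq_big => [[v g]|[v g]] /=.
  rewrite updK; have [gu|gu] := eqVneq (g u) t0; last first.
    rewrite andbF; apply/esym; apply: contraNF gu.
    by case/andP => _ /andP[/layeredP[/(_ u)]]; rewrite !inE eqxx => -> //.
  rewrite andbT -andbA (andbC `[< _ >]) andbA layered_update // -andbA.
  apply: andb_id2l => vL; apply: andb_id2l => gL; apply: asbool_equiv_eq.
  have := layered_update v uA gu; rewrite vL gL => /andP[fL ufA].
  apply: (merging_restrict fL (subD1set A u)) => z.
    by rewrite !inE ffunE => /andP[/negbTE ->].
  move=> zA; rewrite in_setD1; have /layeredP[_ onA] := fL; rewrite (onA z zA).1 andbT.
  by apply: contraNneq ufA => {1}<-; apply: imset_f.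
case/andP => _ _; rewrite /map_weight (bigD1 u) //= ffunE eqxx; congr (_ * _).
apply: eq_big => z; first by rewrite !inE andbC.
by case/andP => _ /negbTE zu; rewrite ffunE zu.
Qed.

(** * The closed form in layer sums, and its proof by induction *)

Definition merging_value A x : R :=
  \prod_i layer_sum A x (ordS i) ^+ #|layer A i|
  - \prod_i layer_sum A x (ordS i) ^+ (#|layer A i| - 2)
    * \prod_i (layer_sum A x i ^+ 2 - layer_sum2 A x i).

Lemma layer_sum2_singleton A x i : #|layer A i| = 1%N ->
  layer_sum2 A x i = layer_sum A x i ^+ 2.
Proof.
by move=> /eqP/cards1P[w Ai]; rewrite /layer_sum2 /layer_sum Ai !big_set1.
Qed.

(** Over one point the squared sum equals the sum of squares, so the subtracted term vanishes
    whatever its truncated exponents. *)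
Lemma merging_value_singleton A x i : #|layer A i| = 1%N ->
  merging_value A x = \prod_i layer_sum A x (ordS i) ^+ #|layer A i|.
Proof.
move=> Ai; rewrite /merging_value [X in _ - _ * X](bigD1 i) //=.
by rewrite layer_sum2_singleton // subrr mul0r mulr0 subr0.
Qed.

(** Since [x u = 0], no layer sum changes; only the exponent attached to the layer of [u] drops by
    one. *)
Lemma merging_value_remove A u x : u \in A -> x u = 0 ->
  (1 < #|layer A (lay u)|)%N ->
  merging_value A x = layer_sum A x (ordS (lay u)) * merging_value (A :\ u) x.
Proof.
move=> uA xu cardA; set B := A :\ u.
have uL : u \in layer A (lay u) by rewrite inE uA eqxx.
have sumB (F : T -> R) i : F u = 0 -> \sum_(v in layer B i) F v = \sum_(v in layer A i) F v.
  move=> Fu; rewrite layer_setD1 [RHS](bigID (pred1 u)) /= [X in _ = X + _]big1 ?add0r.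
    by apply: eq_bigl => v; rewrite in_setD1 andbC.
  by move=> v /andP[_ /eqP ->].
have SB i : layer_sum B x i = layer_sum A x i by exact: sumB.
have S2B i : layer_sum2 B x i = layer_sum2 A x i.
  by apply: (sumB (fun v => x v ^+ 2)); rewrite xu expr0n.
have cardB i : i != lay u -> #|layer B i| = #|layer A i|.
  move=> iu; rewrite layer_setD1; congr #|pred_of_set _|; apply/setDidPl.
  by rewrite disjoint_sym disjoints1 inE eq_sym (negbTE iu) andbF.
have cardBu : #|layer A (lay u)| = #|layer B (lay u)|.+1.
  by rewrite layer_setD1 (cardsD1 u) uL.
rewrite /merging_value mulrBr mulrA; congr (_ - _).
  rewrite (bigD1 (lay u)) //= [in RHS](bigD1 (lay u)) //= mulrA SB cardBu exprS.
  by congr (_ * _); apply: eq_bigr => i iu; rewrite SB cardB.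
under [in RHS]eq_bigr do rewrite SB.
under [X in _ = _ * X]eq_bigr do rewrite SB S2B.
(* For two vertices both truncated exponents are 0 and nothing drops; but removing [u] leaves one
   vertex, so the factor of that layer is 0. *)
have [card2|card2] := eqVneq #|layer A (lay u)| 2.
  suff -> : \prod_i (layer_sum A x i ^+ 2 - layer_sum2 A x i) = 0 by rewrite !mulr0.
  rewrite (bigD1 (lay u)) //= -SB -S2B layer_sum2_singleton ?subrr ?mul0r //.
  by lia.
congr (_ * _).
rewrite (bigD1 (lay u)) //= [in RHS](bigD1 (lay u)) //= mulrA -exprS.
congr (_ ^+ _ * _); first by lia.
by apply: eq_bigr => i iu; rewrite cardB.
Qed.

Lemma sum_merging A x : (forall i, (0 < #|layer A i|)%N) ->
  \sum_(f in layered A | `[< merging A f >]) map_weight A x f = merging_value A x.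
Proof.
have [n] := ubnP #|A|; elim: n A x => // n IHn A x leAn A_gt0.
have [/existsP[i /eqP Ai]|/existsPn no1] := boolP [exists i, #|layer A i| == 1%N].
  rewrite (merging_value_singleton _ Ai) -sum_layered_weight.
  apply: eq_bigl => f; case: (boolP (f \in _)) => //= fA.
  by apply/asboolP; apply: singleton_merging fA Ai.
(* Two vertices per layer provide the pairs [p i], [q i] and keep every layer nonempty once a vertex
   is removed. *)
have A_gt1 i : (1 < #|layer A i|)%N by have := no1 i; have := A_gt0 i; lia.
have [pq pqP] : exists pq : 'I_k -> T * T, forall i,
    [/\ (pq i).1 \in layer A i, (pq i).2 \in layer A i & (pq i).1 != (pq i).2].
  apply: (@fin_all_exists _ _ (fun i (z : T * T) =>
    [/\ z.1 \in layer A i, z.2 \in layer A i & z.1 != z.2])) => i.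
  by have /card_gt1P[a [b [? ? ?]]] := A_gt1 i; exists (a, b).
pose p i := (pq i).1; pose q i := (pq i).2.
pose c f : R := `[< merging A f >]%:R - 1 + \prod_i (f (p i) != f (q i))%:R.
have cE y : \sum_(f in layered A) c f * map_weight A y f =
    \sum_(f in layered A | `[< merging A f >]) map_weight A y f - merging_value A y.
  rewrite /merging_value -sum_layered_weight opprB addrA.
  rewrite -(@sum_layered_separated _ _ p q) => [|i|i|i]; try by case: (pqP i).
  rewrite big_mkcondr /= addrAC -sumrB -big_split /=; apply: eq_bigr => f _.
  by rewrite /c mulrDl mulrBl mul1r; case: ifP => _; rewrite ?mul1r ?mul0r.
apply/eqP; rewrite -subr_eq0 -cE; apply/eqP/weighted_sum_eq0 => {x} [x u uA|f fA fonto].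
  rewrite cE; have yu : kill u x u = 0 by rewrite /kill eqxx.
  rewrite (merging_value_remove uA yu) // (sum_merging_remove uA yu) IHn ?subrr //.
    by move: leAn; rewrite (cardsD1 u) uA.
  move=> i; have := A_gt1 i; rewrite layer_setD1 (cardsD1 u (layer A i)).
  by case: (u \in _) => /=; lia.
have finj : {in A &, injective f}.
  by apply/imset_injP; rewrite eqn_leq leq_imset_card subset_leq_card.
have pqf i : f (p i) != f (q i).
  have [] := pqP i; rewrite !inE => /andP[pA _] /andP[qA _].
  by apply: contra_neq => /finj; apply.
rewrite /c big1 ?subrK => [|i _]; last by rewrite pqf.
(* One pair that never merges suffices; [lay t0] is just some layer index. *)
have [pA qA neq_pq] := pqP (lay t0).
move: pA qA; rewrite !inE => /andP[pA /eqP lp] /andP[qA /eqP lq].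
case: asboolP => // /(inj_not_merging fA finj pA qA _ neq_pq) []; by rewrite lp.
Qed.

End LayeredMaps.

(** * Traces of tensor powers and exterior squares *)

Section Traces.
Variable F : fieldType.

Lemma mxtrace_tens m n (A : 'M[F]_m) (B : 'M[F]_n) : \tr (A *t B) = \tr A * \tr B.
Proof. by rewrite /mxtrace mulr_sum; apply: eq_bigr => i _; rewrite mxE. Qed.

(** The squared sum runs over ordered pairs: the diagonal gives the sum of squares, and a swap
    matches the two triangles. *)
Lemma mxtrace_ext2_diag n (d : 'rV[F]_n) :
  2 * \tr (ext2mx (diag_mx d)) = (\sum_j d 0 j) ^+ 2 - \sum_j d 0 j ^+ 2.
Proof.
have -> : \tr (ext2mx (diag_mx d)) = \sum_(p in wpairs n) d 0 p.1 * d 0 p.2.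
  rewrite [RHS]big_enum_val; apply: eq_bigr => i _; rewrite !mxE /= !mxE /= !mxE !eqxx.
  have := enum_valP i; rewrite inE => /ltn_eqF; rewrite val_eqE => p12.
  by rewrite p12 mulr0n mulr0 subr0.
rewrite expr2 big_distrlr pair_big /=.
rewrite [in RHS](bigID (fun p : 'I_n * 'I_n => p.1 == p.2)) /=.
have -> : \sum_(p : 'I_n * 'I_n | p.1 == p.2) d 0 p.1 * d 0 p.2 = \sum_j d 0 j ^+ 2.
  rewrite (reindex_onto (fun j : 'I_n => (j, j)) fst) /=; last by move=> [a b] /= /eqP ->.
  by apply: eq_big => [j|j _]; rewrite ?eqxx // expr2.
rewrite addrAC subrr add0r [in RHS](bigID (fun p : 'I_n * 'I_n => (p.1 < p.2)%N)) /=.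
rewrite mulr2n mulrDl mul1r; congr (_ + _).
  by apply: eq_bigl => -[a b]; rewrite inE /= -val_eqE; case: ltngtP.
rewrite [RHS](reindex (fun p : 'I_n * 'I_n => (p.2, p.1))) /=; last first.
  by exists (fun p : 'I_n * 'I_n => (p.2, p.1)) => -[].
apply: eq_big => [[a b]|p _]; last by rewrite mulrC.
by rewrite inE /= -val_eqE; case: ltngtP.
Qed.

Variable G : groupType.
Implicit Types (V W : rep F G) (g : G).

Lemma tr_rep_tens V W g : \tr (rep_tens V W g) = \tr (V g) * \tr (W g).
Proof. exact: mxtrace_tens. Qed.

Lemma tr_rep_tpow V n g : \tr (rep_tpow V n g) = \tr (V g) ^+ n.
Proof.
elim: n => [|n IHn]; first by rewrite /= mxtrace1.
by rewrite exprS -IHn -tr_rep_tens.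
Qed.

Lemma tr_rep_bigtens k (V : 'I_k -> rep F G) g :
  \tr (rep_bigtens V g) = \prod_i \tr (V i g).
Proof.
rewrite /rep_bigtens; apply: (big_morph (fun W : rep F G => \tr (W g))) => [V1 V2|].
  exact: tr_rep_tens.
by rewrite /= mxtrace1.
Qed.

End Traces.

(** * Tuples of maps as layered self-maps of the disjoint union *)

Section KTuples.
Variables (k : nat) (X : 'I_k -> finType).
Notation vertex := {i : 'I_k & X i}.

Lemma big_layer (R : Type) (idx : R) (op : Monoid.com_law idx) i (F : vertex -> R) :
  \big[op/idx]_(u in layer (@tag _ X) setT i) F u
  = \big[op/idx]_(v : X i) F (Tagged X v).
Proof.
transitivity (\big[op/idx]_(j | j == i) \big[op/idx]_(v : X j) F (Tagged X v)).
  rewrite (sig_big_dep _ (fun _ => predT) (fun j v => F (Tagged X v))) /=.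
  by apply: eq_big => -[j v]; rewrite ?inE ?andbT.
by rewrite big_pred1_eq.
Qed.

Lemma card_layer i : #|layer (@tag _ X) setT i| = #|X i|.
Proof. by rewrite -!sum1_card big_layer. Qed.

Definition step_ffun (f : ktuple X) : {ffun vertex -> vertex} :=
  [ffun u => ktuple_step f u].

Lemma step_ffun_layered t0 f : step_ffun f \in layered t0 (@tag _ X) setT.
Proof. by apply/layeredP; split=> v; rewrite ?inE // ffunE. Qed.

Lemma iter_step_ffun f m u : iter m (step_ffun f) u = iter m (ktuple_step f) u.
Proof. by elim: m => //= m ->; rewrite ffunE. Qed.

Lemma iter_ktuple_round f m i (v : X i) :
  Tagged X (iter m (@ktuple_round _ _ f i) v)
  = iter (m * k) (ktuple_step f) (Tagged X v).
Proof. by elim: m => //= m IHm; rewrite ktuple_roundE IHm -iterD. Qed.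

Lemma merging_eventually_constant (hk : (0 < k)%N) (v0 : X (Ordinal hk)) f :
  merging (@tag _ X) setT (step_ffun f) <-> eventually_constant hk f.
Proof.
split=> [[m mP]|[m m_gt0 [c cP]]].
  exists m.+1 => //; exists (iter m.+1 (@ktuple_round _ _ f _) v0) => v.
  apply: (@eq_from_Tagged _ X); rewrite !iter_ktuple_round.
  have mk : (m <= m.+1 * k)%N by rewrite (leq_trans (leqnSn m)) ?leq_pmulr.
  rewrite -(subnK mk) !iterD -!iter_step_ffun; congr iter.
  by apply: mP; rewrite ?inE.
exists (m * k + k)%N => u v _ _ luv.
have toc w : tag w = tag u -> iter (m * k + k) (step_ffun f) w
    = iter (tag u) (ktuple_step f) (Tagged X c).
  move=> wu; have uk := ltn_ord (tag u).
  (* From layer [tag u], [k - tag u] steps reach layer 0, [m] rounds collapse it to [c], and [tag u]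
     further steps return to the starting layer. *)
  have -> : (m * k + k = tag u + (m * k + (k - tag u)))%N by lia.
  rewrite iter_step_ffun !iterD; congr iter.
  have := tag_iter_ktuple_step f (k - tag u) w.
  rewrite wu subnKC 1?ltnW // modnn; case: (iter _ _ w) => j y /= j0.
  have {}j0 : j = Ordinal hk by exact: val_inj.
  by case: _ / (esym j0) y => y; rewrite -iter_ktuple_round cP.
by rewrite !toc.
Qed.

Lemma poly_at_EC (F : fieldType) (hk : (0 < k)%N) (x : vertex -> F)
    (d : forall i, X i) :
  poly_at (EC_poly X F hk) x
  = merging_value (@tag _ X) setT x.
Proof.
pose t0 := Tagged X (d (Ordinal hk)).
rewrite -(sum_merging t0) => [|i]; last first.
  by rewrite card_layer; apply/card_gt0P; exists (d i).
rewrite /poly_at /EC_poly raddf_sum /=.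
pose unstep (g : {ffun vertex -> vertex}) : ktuple X :=
  [ffun i => [ffun v => tagged_as (Tagged X (d (ordS i))) (g (Tagged X v))]].
have unstepK : cancel step_ffun unstep.
  move=> f; apply/ffunP => i; rewrite ffunE; apply/ffunP => v; rewrite !ffunE.
  by rewrite (@tagged_asE _ X).
have stepK g : g \in layered t0 (@tag _ X) setT -> step_ffun (unstep g) = g.
  move=> /layeredP[_ onT]; apply/ffunP => -[i v].
  rewrite ffunE /ktuple_step /= !ffunE.
  have := (onT (Tagged X v) (in_setT _)).2; case: (g _) => j y /= ji.
  by case: _ / (esym ji) y => y; rewrite (@tagged_asE _ X).
rewrite [RHS](reindex_onto step_ffun unstep) => [|g /andP[/stepK]] //.
apply: eq_big => [f|f _].
  rewrite inE step_ffun_layered unstepK eqxx andbT; apply: asbool_equiv_eq.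
  by apply: iff_sym; apply: merging_eventually_constant.
rewrite /weight /map_weight rmorph_prod /=.
rewrite [RHS](partition_big (@tag _ X) predT) //=; apply: eq_bigr => i _.
rewrite rmorph_prod /=.
transitivity (\prod_(v : X i) x (step_ffun f (Tagged X v))).
  by apply: eq_bigr => v _; rewrite mevalXU enum_rankK ffunE.
by rewrite -(big_layer _ _ (fun u => x (step_ffun f u))); apply: eq_bigl => u; rewrite !inE.
Qed.

Lemma tr_fundV_torus (F : fieldType) (x : vertex -> F) (x0 : forall u, x u != 0) i :
  \tr (fundV X F i (torus x0)) = layer_sum (@tag _ X) setT x i.
Proof.
rewrite /layer_sum big_layer /= /prodG_proj ffunE /= mxtrace_diag.
rewrite [RHS](reindex _ (onW_bij _ (enum_val_bij (X i)))) /=.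
by apply: eq_bigr => j _; rewrite mxE.
Qed.

Lemma tr_ext2_torus (F : fieldType) (x : vertex -> F) (x0 : forall u, x u != 0) i :
  2 * \tr (rep_ext2 (fundV X F i) (torus x0))
  = layer_sum (@tag _ X) setT x i ^+ 2 - layer_sum2 (@tag _ X) setT x i.
Proof.
rewrite /= /prodG_proj ffunE /= mxtrace_ext2_diag /layer_sum /layer_sum2 !big_layer.
rewrite ![in RHS](reindex _ (onW_bij _ (enum_val_bij (X i)))) /=.
by congr (_ ^+ 2 - _); apply: eq_bigr => j _; rewrite mxE.
Qed.

End KTuples.

(** Over the infinite field [R[i]], values at points with nonzero coordinates determine the
    polynomial. If some [X i] is a singleton, its exterior square has dimension 0, so the second
    tensor product contributes 0 despite truncated exponents. *)
Theorem corollary3p3 (R : realType) (k : nat) (hk : (0 < k)%N)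
    (X : 'I_k -> finType) (hX : forall i, (0 < #|X i|)%N)
    (x : {i : 'I_k & X i} -> R[i]) (x0 : forall u, x u != 0) :
  poly_at (EC_poly X R[i] hk) x =
  chi [:: (1, rep_bigtens (fun i : 'I_k =>
                rep_tpow (fundV X R[i] i) #|X (ord_pred i)|));
          (- (2 ^+ k), rep_bigtens (fun i : 'I_k =>
                rep_tens (rep_tpow (fundV X R[i] i) (#|X (ord_pred i)| - 2))
                         (rep_ext2 (fundV X R[i] i))))] x0.
Proof.
rewrite (poly_at_EC hk x (fun i => enum_val (Ordinal (hX i)))).
rewrite /chi /virtual_char big_cons big_seq1 /= mul1r !tr_rep_bigtens.
rewrite rmorphN rmorphXn mulNr.
under [in RHS]eq_bigr do rewrite tr_rep_tpow tr_fundV_torus.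
under [X in _ - _ * X]eq_bigr do rewrite tr_rep_tens tr_rep_tpow tr_fundV_torus.
rewrite /merging_value.
(* [merging_value] indexes exponents by the source layer, the tensor products by the target layer; a
   cyclic shift reconciles them. *)
have reord (e : nat -> nat) :
    \prod_i layer_sum (@tag _ X) setT x (ordS i) ^+ e #|layer (@tag _ X) setT i|
    = \prod_i layer_sum (@tag _ X) setT x i ^+ e #|X (ord_pred i)|.
  rewrite [RHS](reindex_inj (can_inj (@ordSK k))) /=.
  by apply: eq_bigr => i _; rewrite ordSK card_layer.
rewrite (reord id) (reord (subn^~ 2)) [in RHS]big_split /= mulrCA; congr (_ - _ * _).
(* Spreading [2 ^+ k] as one factor 2 per index matches [tr_ext2_torus] factor by factor. *)
rewrite -[k in 2 ^+ k]card_ord -prodr_const -big_split /=.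
by apply: eq_bigr => i _; rewrite tr_ext2_torus.
Qed.
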